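(* Let $a,b$ be integers with $a>0$ and $b<0$, and let $\{P_n(x)\}_{n=0}^{\infty}$ be the polynomial sequence with generating function $$\sum_{n=0}^{\infty}P_n(x)\frac{z^n}{n!}=e^{xz+az^2+bz^4}.$$ Consider the marked generating tree whose root (at level $0$) is a single non-marked node $(0)$, and whose nodes produce children according to the succession rule, for every $k\ge 0$, $$(k)\rightarrow(\overline{k-3})^{24|b|\binom{k}{3}}\,(k-1)^{2ak}\,(k+1)^1,\qquad (\bar k)\rightarrow(k-3)^{24|b|\binom{k}{3}}\,(\overline{k-1})^{2ak}\,(\overline{k+1})^1 .$$ For $n\ge 0$ and $k=0,1,\ldots,n$, let $\mu_n(k)$ and $\mu_n(\bar k)$ denote respectively the number of non-marked nodes $(k)$ and the number of marked nodes $(\bar k)$ at level $n$ of this tree. Then $$[x^k]P_n(x)=\mu_n(k)-\mu_n(\bar k).$$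
   Context: $[x^k]P_n(x)$ denotes the coefficient of $x^k$ in $P_n(x)$. A marked generating tree is a rooted labeled tree in which every node carries either a non-marked label $k$ (such a node is denoted $(k)$) or a marked label $\bar k$ (denoted $(\bar k)$), with $k$ a nonnegative integer. The succession rule specifies the children of each node in terms of its label: a node at level $n$ with the label on the left of the arrow has as its children, at level $n+1$, exactly the nodes listed on the right, where $(i)^p$ (resp. $(\bar i)^p$) means $p$ nodes with label $i$ (resp. $\bar i$), and exponent $0$ means no such node (so, e.g., no node with label $k-3$ is produced when $k<3$, and no node with label $k-1$ is produced when $k=0$). *)

(* Defs.v *)
From HB Require Import structures.
From mathcomp Require Import all_boot all_order all_algebra.

Set Implicit Arguments.
Unset Strict Implicit.
Unset Printing Implicit Defensive.

Import Order.TTheory GRing.Theory Num.Theory.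
Local Open Scope ring_scope.

(* [{poly {poly R}}] is read as R[x][z]: the outer variable ['X] is z and
   ['X%:P] is x. *)
Definition exponent (R : numFieldType) (a b : int) : {poly {poly R}} :=
  'X%:P * 'X + a%:~R * 'X^2 + b%:~R * 'X^4.

(* [sum_n P n * z^n / n! = exp F] in R[x][[z]]. The series exp F is the z-adic
   limit of the partial sums [\sum_(m < N) F ^+ m / m!]: for each n, their
   coefficient of z^n is eventually constant in N. *)
Definition egf_is_exp (R : numFieldType) (P : nat -> {poly R})
    (F : {poly {poly R}}) : Prop :=
  forall n : nat, exists N0 : nat, forall N : nat, (N0 <= N)%N ->
    \sum_(m < N) (m`!%:R)^-1 *: (F ^+ m)`_n = (n`!%:R)^-1 *: P n.

(* The boolean records whether the label is marked. *)
Definition label : Type := (nat * bool)%type.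
Definition unmarked (k : nat) : label := (k, false).
Definition marked (k : nat) : label := (k, true).

(* Level n of the generating tree, as the sequence of the labels of its nodes
   (one entry per node). *)
Fixpoint level (root : label) (rule : label -> seq label) (n : nat) :
    seq label :=
  if n is n'.+1 then flatten [seq rule l | l <- level root rule n']
  else [:: root].

(* [k - 3] and [k - 1] are truncated subtractions, harmless because the
   multiplicity is 0 whenever truncation occurs. As a > 0, [`|a|] is a itself,
   seen as a natural number. *)
Definition succession (a b : int) (l : label) : seq label :=
  match l with
  | (k, false) =>
      nseq (24 * `|b| * 'C(k, 3))%N (marked (k - 3)%N)
      ++ nseq (2 * `|a| * k)%N (unmarked (k - 1)%N)
      ++ nseq 1 (unmarked (k + 1)%N)
  | (k, true) =>
      nseq (24 * `|b| * 'C(k, 3))%N (unmarked (k - 3)%N)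
      ++ nseq (2 * `|a| * k)%N (marked (k - 1)%N)
      ++ nseq 1 (marked (k + 1)%N)
  end.

Definition mu (a b : int) (n : nat) (l : label) : nat :=
  count_mem l (level (unmarked 0) (succession a b) n).

(* Main.v *)
(** Let G = exp (x z + a z^2 + b z^4). From dG/dz = (x + 2 a z + 4 b z^3) G and
    dG/dx = z G one gets the recurrence P_(n+1) = x P_n + 2 a P_n' + 4 b P_n'''.
    As 4 k (k-1) (k-2) = 24 'C(k, 3), the operator x + 2 a D + 4 b D^3 sends
    x^k to the signed sum of the children of the node (k), marked nodes being
    counted negatively. *)

Require Import Defs.
From HB Require Import structures.
From mathcomp Require Import all_boot all_order all_algebra.

Set Implicit Arguments.
Unset Strict Implicit.
Unset Printing Implicit Defensive.

Import Order.TTheory GRing.Theory Num.Theory.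
Local Open Scope ring_scope.

(** The partial derivative in the inner variable x. As [swapXY] is a ring morphism, conjugating by
    it transfers the product and power rules of the outer derivative. *)
Definition deriv_x (R : comNzRingType) (G : {poly {poly R}}) : {poly {poly R}} :=
  swapXY (swapXY G)^`().

Lemma coef_deriv_x (R : comNzRingType) (G : {poly {poly R}}) (n : nat) :
  (deriv_x G)`_n = (G`_n)^`().
Proof.
by apply/polyP => i; rewrite coef_deriv coef_swapXY coef_deriv coefMn coef_swapXY.
Qed.

Lemma deriv_x_exp (R : comNzRingType) (G : {poly {poly R}}) (m : nat) :
  deriv_x (G ^+ m) = deriv_x G * G ^+ m.-1 *+ m.
Proof.
by rewrite /deriv_x rmorphXn deriv_exp rmorphMn rmorphM rmorphXn /= swapXYK.
Qed.

Lemma deriv_x_mulX (R : comNzRingType) (G : {poly {poly R}}) :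
  deriv_x ('X * G) = 'X * deriv_x G.
Proof.
by apply/polyP => -[|n]; rewrite coef_deriv_x !coefXM /= ?coef_deriv_x ?raddf0.
Qed.

(** Partial sums of the exponential stay polynomials in z, so both derivatives apply without formal
    power series. *)
Definition exp_trunc (R : numFieldType) (F : {poly {poly R}}) (N : nat) :
    {poly {poly R}} :=
  \sum_(m < N) (m`!%:R^-1)%:P *: F ^+ m.

Lemma coef_exp_trunc (R : numFieldType) (F : {poly {poly R}}) (N n : nat) :
  (exp_trunc F N)`_n = \sum_(m < N) (m`!%:R)^-1 *: (F ^+ m)`_n.
Proof. by rewrite coef_sum; apply: eq_bigr => m _; rewrite coefZ mul_polyC. Qed.

Lemma scale_invf_factS (R : numFieldType) (m : nat) (G : {poly {poly R}}) :
  (m.+1`!%:R^-1)%:P *: (G *+ m.+1) = (m`!%:R^-1)%:P *: G.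
Proof.
rewrite -scaler_nat scalerA -[m.+1%:R](rmorph_nat (@polyC R)) -polyCM.
by rewrite factS natrM invfM mulrAC mulVf ?mul1r // pnatr_eq0.
Qed.

(** The term of index 0 dies and the term of index m + 1 becomes F' times the term of index m, so
    the truncation order drops by exactly one. *)
Lemma deriv_exp_trunc (R : numFieldType) (F : {poly {poly R}}) (N : nat) :
  (exp_trunc F N.+1)^`() = F^`() * exp_trunc F N.
Proof.
rewrite /exp_trunc big_ord_recl derivD derivZ expr0 derivC scaler0 add0r.
rewrite raddf_sum mulr_sumr; apply: eq_bigr => m _ /=.
by rewrite derivZ deriv_exp scale_invf_factS scalerAr.
Qed.

Lemma deriv_x_exp_trunc (R : numFieldType) (F : {poly {poly R}}) (N : nat) :
  deriv_x (exp_trunc F N.+1) = deriv_x F * exp_trunc F N.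
Proof.
have -> : deriv_x (exp_trunc F N.+1)
    = \sum_(m < N.+1) (m`!%:R^-1)%:P *: deriv_x (F ^+ m).
  apply/polyP => n; rewrite coef_deriv_x !coef_sum raddf_sum.
  apply: eq_bigr => m _ /=.
  by rewrite !coefZ !mul_polyC derivZ coef_deriv_x.
rewrite big_ord_recl deriv_x_exp mulr0n scaler0 add0r mulr_sumr.
by apply: eq_bigr => m _; rewrite deriv_x_exp scale_invf_factS scalerAr.
Qed.

Lemma deriv_exponent (R : numFieldType) (a b : int) :
  (exponent R a b)^`() = 'X%:P + (2 * a)%:~R * 'X + (4 * b)%:~R * 'X^3.
Proof.
have D (c : int) m :
    (c%:~R * 'X^m : {poly {poly R}})^`() = (m%:Z * c)%:~R * 'X^(m.-1).
  by rewrite !mulrzl raddfMz /= derivXn pmulrn -mulrzA.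
by rewrite /exponent !derivD derivM derivC derivX mul0r add0r mulr1 !D expr1.
Qed.

Lemma deriv_x_exponent (R : numFieldType) (a b : int) :
  deriv_x (exponent R a b) = 'X.
Proof.
(* Once the variables are swapped, a monomial in z alone is constant in the outer variable. *)
have D (c : int) m : (swapXY (c%:~R * 'X^m : {poly {poly R}}))^`() = 0.
  rewrite rmorphM rmorph_int rmorphXn /= swapXY_X.
  by rewrite -(rmorph_int (@polyC {poly R})) -rmorphXn -rmorphM derivC.
rewrite /deriv_x /exponent 2!rmorphD 2!derivD !D !addr0 rmorphM /=.
rewrite swapXY_polyC map_polyX swapXY_X.
by rewrite derivM derivX derivC mul1r mulr0 addr0 swapXY_polyC map_polyX.
Qed.

(** Each factor z is traded for one x-derivative, which costs one truncation order. The orders N, N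
    + 1 and N + 3 compensate for 0, 1 and 3 such derivatives and make the identity exact. *)
Lemma coef_exp_exponentS (R : numFieldType) (a b : int) (N n : nat) :
  let E N n := (exp_trunc (exponent R a b) N)`_n in
  E N.+1 n.+1 *+ n.+1 =
    'X * E N n + (2 * a)%:~R * (E N.+1 n)^`() + (4 * b)%:~R * (E N.+3 n)^`(3).
Proof.
move=> E.
have dE k : deriv_x (exp_trunc (exponent R a b) k.+1)
    = 'X * exp_trunc (exponent R a b) k.
  by rewrite deriv_x_exp_trunc deriv_x_exponent.
rewrite -coef_deriv deriv_exp_trunc deriv_exponent !mulrDl !coefD coefCM.
rewrite -!(rmorph_int (@polyC {poly R})) -!mulrA !coefCM.
rewrite /E -!coef_deriv_x !derivnS derivn0 -!coef_deriv_x !dE.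
by do 2!rewrite !deriv_x_mulX !dE.
Qed.

Definition diffop (R : numFieldType) (a b : int) (p : {poly R}) : {poly R} :=
  'X * p + (2 * a)%:~R * p^`() + (4 * b)%:~R * p^`(3).

Lemma diffopZ (R : numFieldType) (a b : int) (c : R) (p : {poly R}) :
  diffop a b (c *: p) = c *: diffop a b p.
Proof. by rewrite /diffop derivZ derivnZ -!scalerAr -!scalerDr. Qed.

Lemma diffop_sum (R : numFieldType) (a b : int) (I : Type) (s : seq I)
    (f : I -> {poly R}) :
  diffop a b (\sum_(i <- s) f i) = \sum_(i <- s) diffop a b (f i).
Proof.
by rewrite /diffop !big_split /= !raddf_sum /= !mulr_sumr.
Qed.

(** The exponent has no constant term in z, so only its power 0 contributes to z^0. *)
Lemma egf_exponent0 (R : numFieldType) (a b : int) (P : nat -> {poly R}) :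
  egf_is_exp P (exponent R a b) -> P 0%N = 1.
Proof.
(* A successor order guarantees that the term of index 0 is present. *)
case/(_ 0%N) => N0 /(_ N0.+1 (leqnSn _)).
rewrite fact0 invr1 scale1r => <-.
rewrite big_ord_recl expr0 coefC /= invr1 scale1r big1 ?addr0 // => m _.
rewrite -horner_coef0 horner_exp /exponent !hornerE /=.
by rewrite !mulr0 addr0 expr0n scaler0.
Qed.

Lemma egf_exponentS (R : numFieldType) (a b : int) (P : nat -> {poly R}) (n : nat) :
  egf_is_exp P (exponent R a b) -> P n.+1 = diffop a b (P n).
Proof.
move=> hP; have [N0 h0] := hP n; have [N1 h1] := hP n.+1.
(* Beyond both thresholds, the coefficients of z^n and z^(n+1) no longer depend on the truncation
   order, so the shifted orders in the recurrence can be identified. *)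
pose N := maxn N0 N1.
have E0 i : (exp_trunc (exponent R a b) (N + i))`_n = (n`!%:R)^-1 *: P n.
  by rewrite coef_exp_trunc h0 // (leq_trans (leq_maxl N0 N1)) ?leq_addr.
have E1 : (exp_trunc (exponent R a b) N.+1)`_n.+1 = (n.+1`!%:R)^-1 *: P n.+1.
  by rewrite coef_exp_trunc h1 // (leq_trans (leq_maxr N0 N1)).
have := coef_exp_exponentS R a b N n; rewrite /= E1.
rewrite -(addn0 N) -!addnS !E0 -/(diffop a b _) diffopZ.
rewrite -scaler_nat scalerA factS natrM invfM mulrA mulfV ?pnatr_eq0 // mul1r.
by apply: scalerI; rewrite invr_eq0 pnatr_eq0 -lt0n fact_gt0.
Qed.

Definition weight (R : numFieldType) (l : label) : {poly R} :=
  (-1) ^+ l.2 *: 'X^(l.1).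

Lemma coef_sum_weight (R : numFieldType) (s : seq label) (k : nat) :
  (\sum_(l <- s) weight R l)`_k
  = (count_mem (unmarked k) s)%:R - (count_mem (marked k) s)%:R.
Proof.
elim: s => [|[j e] s IHs]; first by rewrite big_nil coef0 subr0.
rewrite big_cons coefD IHs /= !natrD opprD addrACA; congr (_ + _).
rewrite coefZ coefXn !xpair_eqE eq_sym.
by case: e; case: (j == k); rewrite /= ?mulr0 ?mulr1 ?subr0 ?sub0r.
Qed.

Lemma sum_nseq (V : nmodType) (T : Type) (m : nat) (x : T) (f : T -> V) :
  \sum_(y <- nseq m x) f y = f x *+ m.
Proof. by rewrite big_nseq iter_addr_0. Qed.

(** Since b = -|b|, the third-derivative term enters with a minus sign, which is the change of mark
    of the children with label k - 3. *)
Lemma sum_weight_succession (R : numFieldType) (a b : int) (l : label) :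
  0 < a -> b < 0 ->
  \sum_(l' <- succession a b l) weight R l' = diffop a b (weight R l).
Proof.
move=> ha hb.
have ea : a = `|a|%N by rewrite gtz0_abs.
have eb : b = - (`|b|%N : int) by rewrite ltz0_abs ?opprK.
have D k : diffop a b ('X^k : {poly R}) = 'X^(k + 1)
    + 'X^(k - 1) *+ (2 * `|a| * k) - 'X^(k - 3) *+ (24 * `|b| * 'C(k, 3)).
  (* The third derivative yields the falling factorial k(k-1)(k-2) = 3! 'C(k, 3), and 4 * 3! =
     24. *)
  rewrite /diffop derivXn derivnXn -bin_ffact {1}ea {1}eb -exprS addn1 subn1.
  rewrite mulrN mulrNz mulNr !mulrzl -!PoszM -!pmulrn -!mulrnA.
  congr (_ + _ *+ _ - _ *+ _); first exact: mulnC.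
  by rewrite mulnC (mulnC 'C(k, 3)) mulnACA mulnA.
case: l => k [] /=; rewrite !big_cat !sum_nseq big_seq1 /weight /= diffopZ D.
  by rewrite !scaleN1r scale1r !mulNrn opprB opprD (addrC (- 'X^(k + 1))).
by rewrite !scale1r scaleN1r mulNrn addrC (addrC (_ *+ _)).
Qed.

Theorem theorem18 (R : numFieldType) (a b : int) (ha : 0 < a) (hb : b < 0)
    (P : nat -> {poly R}) (hP : egf_is_exp P (exponent R a b))
    (n k : nat) (hk : (k <= n)%N) :
  (P n)`_k = (mu a b n (unmarked k))%:R - (mu a b n (marked k))%:R.
Proof.
(* It suffices that P n be the sum of the weights over level n, an equality of polynomials suited to
   induction on n. *)
rewrite /mu -coef_sum_weight; congr ((polyseq _)`_k).
elim: n {hk} => [|n IHn] /=.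
  by rewrite (egf_exponent0 hP) big_seq1 /weight /= scale1r.
rewrite (egf_exponentS n hP) IHn diffop_sum big_flatten big_map.
by apply: eq_bigr => l _; rewrite sum_weight_succession.
Qed.
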